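(* Let $H(x) = -x\log_2 x - (1-x)\log_2(1-x)$ for $x\in(0,1)$ denote the binary entropy function, and let $$\gamma := \max\Big\{ \tfrac12\big(H(0.5-\varepsilon)+H(2\varepsilon)\big) \colon 0<\varepsilon<0.25\Big\}\approx 0.926.$$ If $n\ge 1$ is an integer and $A\subseteq \mathbb{Z}_4^n$ is progression-free, then $|A|\le 4^{\gamma n}$.
   Context: A subset $A$ of an additively written abelian group $G$ is called progression-free if there do not exist pairwise distinct $a,b,c\in A$ with $a+b=2c$. Here $\mathbb{Z}_4^n$ is the direct sum of $n$ copies of the cyclic group of order $4$. *)

(* Defs.v *)
From HB Require Import structures.
From mathcomp Require Import all_boot all_order all_algebra.
From mathcomp Require Import all_classical all_reals all_analysis.
Set Implicit Arguments. Unset Strict Implicit. Unset Printing Implicit Defensive.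
Import Order.TTheory GRing.Theory Num.Theory.
Import numFieldNormedType.Exports.
Local Open Scope classical_set_scope.
Local Open Scope ring_scope.

Definition progression_free (G : zmodType) (A : {pred G}) : Prop :=
  forall a b c : G, a \in A -> b \in A -> c \in A ->
    a != b -> a != c -> b != c -> a + b <> c *+ 2.

Definition log2 {R : realType} (x : R) : R := ln x / ln 2.

(* Only meaningful for 0 < x < 1, since [ln] is set to 0 on nonpositive reals. *)
Definition entropy {R : realType} (x : R) : R :=
  - x * log2 x - (1 - x) * log2 (1 - x).

Definition is_max {R : realType} (S : set R) (m : R) : Prop :=
  S m /\ ubound S m.

Definition gamma_set (R : realType) : set R :=
  [set 2^-1 * (entropy (2^-1 - e) + entropy (2 * e)) | e in `]0, 4^-1[%classic].
Arguments gamma_set R : clear implicits.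

(* Main.v *)
(* Write a point of Z_4^n as (parity vector, half-bit vector), both in F_2^n.
   For a, b with the same parity vector r, a + b = 2c holds as soon as c has
   parity vector r + h(a) + h(b).  Call a parity vector rich if its
   fibre in A has more than 2 |{J : 2|J| <= d}| elements.  If more than
   |{I : |I| > d}| parity vectors were rich, some nonzero multilinear polynomial P of degree at most d
   would vanish outside the set C of rich parity vectors; by progression-freeness
   the matrix P(r + f + g), for f, g in the fibre over r in C, is then diagonal
   with constant entry P(r), while its rank is at most 2 |{J : 2|J| <= d}|.
   Hence P vanishes on C too, a contradiction.  Summing over all d bounds |A| by
   O(n) ((1 + 1/mu)(1 + mu^2))^n for every mu in (0,1], and the factor O(n) is
   removed by passing to powers of A.  At the root of 2 mu^3 + mu^2 = 1 the base is
   4^gamma: by Gibbs' inequality, the distributions p = mu^2/(1 + mu^2) and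
   q = mu/(1 + mu) give an upper bound for the entropies that does not depend on
   epsilon and is attained at epsilon = q/2. *)

Require Import Defs.
From HB Require Import structures.
From mathcomp Require Import all_boot all_order all_algebra.
From mathcomp Require Import all_classical all_reals all_analysis.
From mathcomp Require Import ring lra.
Set Implicit Arguments. Unset Strict Implicit. Unset Printing Implicit Defensive.
Import Order.TTheory GRing.Theory Num.Theory.
Import numFieldNormedType.Exports.
Import boot.fintype boot.finset.
Local Open Scope ring_scope.

(** * Linear algebra: rank and dimension counts *)

Lemma card_le_rank (F : fieldType) (U I : finType) (X : {set U}) (K : {set I})
    (a b : I -> U -> F) (c : F) :
  c != 0 ->
  {in X &, forall x y, \sum_(k in K) a k x * b k y = c *+ (x == y)} ->
  (#|X| <= #|K|)%N.
Proof.
move=> c0 ab.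
pose M := \matrix_(i < #|X|, j < #|K|) a (enum_val j) (enum_val i).
pose N := \matrix_(j < #|K|, i < #|X|) b (enum_val j) (enum_val i).
(* A nonzero scalar matrix of size [#|X|] has full rank, and here it factors through dimension
   [#|K|]. *)
have MN : M *m N = c *: 1%:M.
  apply/matrixP=> i j; rewrite !mxE.
  under eq_bigr do rewrite !mxE.
  rewrite -(big_enum_val (fun k => a k (enum_val i) * b k (enum_val j))) ab ?enum_valP //.
  by rewrite (inj_eq enum_val_inj) mulr_natr.
have := mxrankM_maxl M N.
by rewrite MN mxrank_scale_nz // mxrank1 => /leq_trans; apply; exact: rank_leq_col.
Qed.

(** More unknowns than equations: [c] is a left kernel vector of the evaluation matrix, extended by
    0 outside [W]. *)
Lemma vanishing_combination (F : fieldType) (I U : finType) (W : {set I})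
    (Z : {set U}) (h : I -> U -> F) :
  (#|Z| < #|W|)%N ->
  exists c : I -> F, [/\ forall i, i \notin W -> c i = 0,
    exists i, c i != 0
    & {in Z, forall x, \sum_i c i * h i x = 0}].
Proof.
move=> ZW; pose M := \matrix_(i < #|W|, j < #|Z|) h (enum_val i) (enum_val j).
have : kermx M != 0.
  rewrite kermx_eq0 /row_free neq_ltn.
  by rewrite (leq_ltn_trans (rank_leq_col M)).
case/rowV0Pn=> v /sub_kermxP vM v0.
have [j vj] : exists j, v 0 j != 0 by apply/rV0Pn.
pose w := enum_val j; have wW : w \in W by exact: enum_valP.
pose c i := if i \in W then v 0 (enum_rank_in wW i) else 0.
exists c; split.
- by move=> i; rewrite /c => /negPf ->.
- by exists w; rewrite /c wW enum_valK_in.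
- move=> x xZ; rewrite (bigID (mem W)) /= [X in _ + X]big1; last first.
    by move=> i /negPf iW; rewrite /c iW mul0r.
  rewrite addr0 big_enum_val.
  have /rowP/(_ (enum_rank_in xZ x)) := vM; rewrite !mxE.
  apply: etrans; apply: eq_bigr => i _.
  by rewrite !mxE /c enum_valP enum_valK_in enum_rankK_in.
Qed.

(** * Multilinear polynomials over F_2 *)

Section Monomials.
Variable T : finType.
Implicit Types (I J L : {set T}) (x y f g : {ffun T -> 'F_2}).

Definition monomial I x : 'F_2 := \prod_(i in I) x i.

Lemma monomial_indicator I J :
  monomial I [ffun i => (i \in J)%:R] = (I \subset J)%:R.
Proof.
rewrite /monomial; case: (boolP (I \subset J)) => [/subsetP IJ | /subsetPn[i iI iJ]].
  by rewrite big1 // => i /IJ; rewrite ffunE => ->.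
by rewrite (bigD1 i) //= ffunE (negPf iJ) mul0r.
Qed.

(** At the indicator of a smallest [J] with [c J != 0] every other term vanishes: its set is not
    inside [J], or its coefficient is 0. *)
Lemma monomial_combination_neq0 (c : {set T} -> 'F_2) I :
  c I != 0 -> exists x, \sum_J c J * monomial J x != 0.
Proof.
move=> cI; case: (@arg_minnP _ I (fun J => c J != 0) (fun J => #|J|) cI) => J cJ Jmin.
exists [ffun i => (i \in J)%:R].
rewrite (bigD1 J) //= big1 ?addr0 ?monomial_indicator ?subxx ?mulr1 // => L LJ.
rewrite monomial_indicator; case: (boolP (L \subset J)) => LsJ; last by rewrite mulr0.
have [-> | cL] := eqVneq (c L) 0; first by rewrite mul0r.
by case/negP: LJ; rewrite eqEcard LsJ Jmin.
Qed.

Lemma monomialD I x y :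
  monomial I (x + y) =
  \sum_(J in {set T} | J \subset I) monomial J x * monomial (I :\: J) y.
Proof.
rewrite /monomial.
(* Padding by 0 and 1 off [I] lets the product run over all of [T]; a set [J] not inside [I] then
   picks up a factor 0. *)
pose a i : 'F_2 := if i \in I then x i else 0.
pose b i : 'F_2 := if i \in I then y i else 1.
transitivity (\prod_i (a i + b i)).
  rewrite big_mkcond; apply: eq_bigr => i _; rewrite /a /b ffunE.
  by case: ifP; rewrite ?add0r.
rewrite (bigA_distr 1) (bigID (fun J : {set T} => J \subset I)) /= [X in _ + X]big1.
  rewrite addr0; apply: eq_bigr => J JI.
  rewrite (bigID (mem J)) /=; congr (_ * _).
    apply: eq_bigr => i iJ; rewrite iJ /a; by rewrite (subsetP JI).
  rewrite [RHS]big_mkcond [LHS]big_mkcond; apply: eq_bigr => i _.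
  by rewrite inE /b; case: (i \in J).
move=> J /subsetPn[i iJ iI]; rewrite (bigD1 i) //= iJ /a (negPf iI) mul0r //.
Qed.

Lemma polynomialD (c : {set T} -> 'F_2) x y :
  \sum_I c I * monomial I (x + y) =
  \sum_J \sum_L (c (J :|: L) *+ [disjoint J & L]) * (monomial J x * monomial L y).
Proof.
under eq_bigr do rewrite monomialD big_distrr.
rewrite (exchange_big_dep predT) //=; apply: eq_bigr => J _.
rewrite [RHS](bigID (fun L => [disjoint J & L])) /= [X in _ = _ + X]big1; last first.
  by move=> L /negPf ->; rewrite mulr0n mul0r.
rewrite addr0 (reindex_onto (fun L => J :|: L) (fun I => I :\: J)) /=.
  have JL L : ((J :|: L) :\: J == L) = [disjoint J & L].
    by rewrite setDUl setDv set0U disjoint_sym; apply/eqP/setDidPl.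
  apply: eq_big => [L | L /andP[_]]; first by rewrite subsetUl JL.
  by rewrite JL => JdL; rewrite JdL (eqP (etrans (JL L) JdL)).
by move=> I /setIidPr JI; rewrite setUC -{2}JI setUC setID.
Qed.

Definition small_sets d : {set {set T}} := [set J : {set T} | (2 * #|J| <= d)%N].
Definition large_sets d : {set {set T}} := [set J : {set T} | (d < #|J|)%N].

(* In each monomial of P(x + f + g), the f-part or the (x + g)-part has degree at
   most d/2; grouping by that part bounds the rank by 2 |small_sets d|. *)
Lemma translate_eq0 (c : {set T} -> 'F_2) d x (X : {set {ffun T -> 'F_2}}) :
  (forall I, (d < #|I|)%N -> c I = 0) ->
  {in X &, forall f g, f != g -> \sum_I c I * monomial I (x + f + g) = 0} ->
  (2 * #|small_sets d| < #|X|)%N ->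
  \sum_I c I * monomial I x = 0.
Proof.
move=> cd Xoff; apply: contraTeq => Px; rewrite -leqNgt.
pose e J L := c (J :|: L) *+ [disjoint J & L].
have e0 J L : J \notin small_sets d -> L \notin small_sets d -> e J L = 0.
  rewrite !inE -!ltnNge /e => dJ dL; case: (boolP [disjoint J & L]) => // JL.
  rewrite cd // -(ltn_pmul2l (isT : (0 < 2)%N)) cardsU disjoint_setI0 // cards0 subn0.
  by rewrite mulnDr mul2n -addnn; apply: (leq_trans _ (leq_add dJ dL)); rewrite addSn ltnS leq_add.
pose S := small_sets d.
(* [k.1] tells which part is small; when it is the [(x + g)]-part, the sum over [J] skips small
   sets, so that no pair is counted twice. *)
pose a (k : bool * {set T}) f :=
  if k.1 then monomial k.2 f
  else \sum_(J | J \notin S) e J k.2 * monomial J f.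
pose b (k : bool * {set T}) g :=
  if k.1 then \sum_L e k.2 L * monomial L (x + g) else monomial k.2 (x + g).
have -> : (2 * #|S| = #|setX [set: bool] S|)%N by rewrite cardsX cardsT card_bool.
apply: (card_le_rank (a := a) (b := b) Px) => f g fX gX.
transitivity (\sum_I c I * monomial I (x + f + g)); last first.
  have [<-|fg] := eqVneq f g; last by rewrite mulr0n Xoff.
  rewrite mulr1n -addrA; congr (\sum_I _ * monomial I _).
  have -> : f + f = 0; last by rewrite addr0.
  by apply/ffunP => i; rewrite !ffunE -mulr2n (mulrn_pchar (pchar_Fp _)).
rewrite -[x + f]addrC -addrA polynomialD.
rewrite (bigID (mem S)) /=.
transitivity (\sum_(k : bool) \sum_(J in S) a (k, J) f * b (k, J) g).
  rewrite pair_big /=; apply: eq_big => [[k J] | [k J] _] //.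
  by rewrite !inE.
rewrite big_bool /=; congr (_ + _).
  apply: eq_bigr => J JS; rewrite /a /b /= big_distrr /=; apply: eq_bigr => L _.
  by rewrite mulrCA.
rewrite exchange_big /= [RHS](bigID (mem S)) /= [X in _ = _ + X]big1 ?addr0.
  apply: eq_bigr => L LS; rewrite /a /b /= big_distrl /=; apply: eq_bigr => J _.
  by rewrite mulrA.
by move=> L LS; rewrite big1 // => J JS; rewrite -/(e J L) e0 // mul0r.
Qed.

Lemma card_rich_le (X : {ffun T -> 'F_2} -> {set {ffun T -> 'F_2}})
    (C : {set {ffun T -> 'F_2}}) d :
  {in C, forall x, {in X x &, forall f g, f != g -> x + f + g \notin C}} ->
  {in C, forall x, (2 * #|small_sets d| < #|X x|)%N} ->
  (#|C| <= #|large_sets d|)%N.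
Proof.
move=> Coff rich; rewrite leqNgt; apply/negP => CL.
(* Points and monomials both number [2 ^ #|T|], so complements reverse the inequality. *)
have : (#|~: C| < #|~: large_sets d|)%N.
  rewrite -(ltn_add2r #|C|) [(_ + #|C|)%N]addnC cardsC card_ffun card_Fp //.
  by rewrite -cardsT -card_powerset powersetT cardsT -(cardsC (large_sets d)) addnC ltn_add2l.
case/(vanishing_combination monomial) => c [cW [I cI] cZ].
have cd J : (d < #|J|)%N -> c J = 0 by move=> dJ; apply: cW; rewrite !inE negbK.
have [x /negP[]] := monomial_combination_neq0 cI.
apply/eqP; have [xC | xC] := boolP (x \in C); last by apply: cZ; rewrite inE.
apply: translate_eq0 cd _ (rich x xC) => f g fX gX fg.
by apply: cZ; rewrite inE Coff.
Qed.

End Monomials.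

(** * Parity fibres in Z_4^T, summed over levels *)

Lemma telescoping_levels (t : nat -> nat) s n :
  (s <= t n)%N -> (s <= t 0 + \sum_(d < n) (t d < s) * t d.+1)%N.
Proof.
(* The last level [d < n] with [t d < s] satisfies [s <= t d.+1]; if there is none, [s <= t 0]. *)
elim: n => [|n IHn] s_le; first by rewrite big_ord0 addn0.
rewrite big_ord_recr /=; case: ltnP => [ts | st].
  by rewrite mul1n !addnA (leq_trans s_le) // leq_addl.
by rewrite mul0n addn0 IHn.
Qed.

Lemma sum_expr_card (R : comNzRingType) (T : finType) (a : R) :
  \sum_(J : {set T}) a ^+ #|J| = (1 + a) ^+ #|T|.
Proof.
transitivity (\prod_(i : T) (a + 1)); last by rewrite prodr_const cardT addrC.
rewrite (bigA_distr 1); apply: eq_big => // J _.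
by rewrite -big_mkcond prodr_const.
Qed.

Section Z4.
Variable T : finType.

(* z = parity z + 2 * half_bit z in 'Z_4 *)
Definition parity (z : 'Z_4) : 'F_2 := (z %% 2)%:R.
Definition half_bit (z : 'Z_4) : 'F_2 := (z %/ 2)%:R.
Definition parityv (a : {ffun T -> 'Z_4}) := [ffun i => parity (a i)].
Definition half_bitv (a : {ffun T -> 'Z_4}) := [ffun i => half_bit (a i)].

(** With common parity p, x + y = 2 (p + h(x) + h(y)), where h is the half bit, and 2 z depends only
    on the parity of z. *)
Lemma Z4_double (x y z : 'Z_4) :
  parity x = parity y -> parity z = parity x + half_bit x + half_bit y ->
  x + y = z *+ 2.
Proof.
case: x => [[|[|[|[|//]]]] ?]; case: y => [[|[|[|[|//]]]] ?] => /eqP // _;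
by case: z => [[|[|[|[|//]]]] ?] => /eqP // _; apply/val_inj.
Qed.

Lemma Z4_ext (x y : 'Z_4) :
  parity x = parity y -> half_bit x = half_bit y -> x = y.
Proof.
case: x => [[|[|[|[|//]]]] ?]; case: y => [[|[|[|[|//]]]] ?] => /eqP // _ /eqP // _;
by apply/val_inj.
Qed.

Lemma card_progression_free (A : {set {ffun T -> 'Z_4}}) :
  (forall a b c, a \in A -> b \in A -> c \in A -> a + b = c *+ 2 -> a = b) ->
  (#|A| <= 2 * 2 ^ #|T| +
     \sum_(d < #|T|) #|large_sets T d| * (2 * #|small_sets T d.+1|))%N.
Proof.
move=> Afree; pose fib (x : {ffun T -> 'F_2}) := [set a in A | parityv a == x].
pose X (x : {ffun T -> 'F_2}) := [set half_bitv a | a in fib x].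
have cardX x : #|X x| = #|fib x|.
  apply: card_in_imset => a b; rewrite !inE => /andP[_ /eqP ax] /andP[_ /eqP bx] ab.
  apply/ffunP => i; apply: Z4_ext.
    by have /ffunP/(_ i) := etrans ax (esym bx); rewrite !ffunE.
  by have /ffunP/(_ i) := ab; rewrite !ffunE.
pose t d := (2 * #|small_sets T d|)%N.
(* If x + h(a) + h(b) is rich, its fibre is nonempty; any c in it satisfies a + b = 2c, which forces
   a = b. *)
have few d : (#|[set x | (t d < #|X x|)%N]| <= #|large_sets T d|)%N.
  apply: (card_rich_le (X := X)) => x; last by rewrite inE.
  rewrite inE => _ _ _ /imsetP[a + ->] /imsetP[b + ->].
  rewrite !inE => /andP[aA /eqP ax] /andP[bA /eqP bx]; apply: contra_neqN => rich.
  have /card_gt0P[c] : (0 < #|fib (x + half_bitv a + half_bitv b)%R|)%N.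
    by rewrite -cardX (leq_ltn_trans _ rich).
  rewrite inE => /andP[cA /eqP/ffunP cx]; congr half_bitv; apply: Afree aA bA cA _.
  apply/ffunP => i; rewrite mulr2n !ffunE -mulr2n; apply: Z4_double.
    by have /ffunP/(_ i) := etrans ax (esym bx); rewrite !ffunE.
  by have := cx i; rewrite -ax !ffunE.
(* At the top level [d = #|T|] there are no large sets, hence no rich vectors. *)
have top x : (#|X x| <= t #|T|)%N.
  rewrite leqNgt; apply/negP => rich; have := few #|T|.
  have -> : large_sets T #|T| = set0.
    by apply/setP=> J; rewrite !inE ltnNge max_card.
  by rewrite cards0 leqn0 cards_eq0 => /eqP/setP/(_ x); rewrite !inE rich.
have t0 : t 0%N = 2%N.
  have -> : t 0%N = (2 * #|[set @finset.set0 T]|)%N; last by rewrite cards1.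
  congr (2 * #|pred_of_set _|)%N.
  by apply/setP=> J; rewrite !inE leqn0 muln_eq0 /= cards_eq0.
have -> : #|A| = (\sum_x #|X x|)%N.
  rewrite -sum1_card (partition_big parityv predT) //=; apply: eq_bigr => x _.
  by rewrite cardX -sum1_card; apply: eq_bigl => a; rewrite inE.
apply: (@leq_trans (\sum_x (t 0 + \sum_(d < #|T|) (t d < #|X x|) * t d.+1))%N).
  by apply: leq_sum => x _; exact: telescoping_levels (top x).
rewrite big_split /= sum_nat_const card_ffun card_Fp // t0 mulnC leq_add2l.
rewrite exchange_big /=; apply: leq_sum => d _; rewrite -big_distrl /= leq_mul2r.
apply/orP; right; apply: leq_trans (few d); rewrite -[leqRHS]sum1_card [leqRHS]big_mkcond /=.
by apply: leq_sum => x _; rewrite inE; case: ltnP.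
Qed.
End Z4.

(** * Exponential bounds by weighting subsets *)

Section Weights.
Variables (R : realFieldType) (T : finType) (mu : R).
Hypotheses (mu_gt0 : 0 < mu) (mu_le1 : mu <= 1).

(** Weighting each [J] by mu^(2|J|) gives the total (1 + mu^2)^|T|, and each small set weighs at
    least mu^d. *)
Lemma card_small_le d : #|small_sets T d|%:R * mu ^+ d <= (1 + mu ^+ 2) ^+ #|T|.
Proof.
rewrite -sum_expr_card mulr_natl -sumr_const.
rewrite [leRHS](bigID (mem (small_sets T d))) /=.
rewrite -[leLHS]addr0 lerD //; last first.
  by rewrite sumr_ge0 // => J _; rewrite exprn_ge0 // exprn_ge0 // ltW.
apply: ler_sum => J; rewrite inE => Jd.
by rewrite -exprM ler_wiXn2l // ltW.
Qed.

Lemma card_large_le d : #|large_sets T d|%:R <= mu ^+ d.+1 * (1 + mu^-1) ^+ #|T|.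
Proof.
rewrite mulrC -ler_pdivrMr ?exprn_gt0 // -exprVn.
rewrite -sum_expr_card mulr_natl -sumr_const.
rewrite [leRHS](bigID (mem (large_sets T d))) /=.
rewrite -[leLHS]addr0 lerD //; last first.
  by rewrite sumr_ge0 // => J _; rewrite exprn_ge0 // invr_ge0 ltW.
apply: ler_sum => J; rewrite inE => Jd.
by rewrite ler_weXn2l // invf_ge1.
Qed.

Lemma card_progression_free_le (A : {set {ffun T -> 'Z_4}}) :
  (forall a b c, a \in A -> b \in A -> c \in A -> a + b = c *+ 2 -> a = b) ->
  #|A|%:R <= (2 * #|T|.+1)%:R * ((1 + mu^-1) * (1 + mu ^+ 2)) ^+ #|T|.
Proof.
move=> /card_progression_free; rewrite -(ler_nat R) => /le_trans; apply.
set n := #|T|; set G := _ * (1 + _).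
rewrite natrD natr_sum natrM mulnS natrD [leRHS]mulrDl lerD //.
  have G2 : 2 <= G by rewrite /G; have : 1 <= mu^-1; [rewrite invf_ge1 | nra].
  by rewrite ler_wpM2l // natrX lerXn2r ?nnegrE // (le_trans _ G2).
have -> : (2 * n)%:R * G ^+ n = \sum_(d < n) 2 * G ^+ n.
  by rewrite sumr_const card_ord natrM mulr_natr mulrnAl.
apply: ler_sum => d _; rewrite natrM natrM mulrCA ler_wpM2l //.
(* The small sets are taken at [d.+1], so mu^(d+1) cancels between the two bounds and every level
   gets the same bound. *)
apply: (le_trans (ler_wpM2r (ler0n _ _) (card_large_le d))).
rewrite exprMn mulrAC mulrC ler_wpM2l ?exprn_ge0 ?addr_ge0 ?invr_ge0 ?(ltW mu_gt0) //.
by rewrite mulrC card_small_le.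
Qed.
End Weights.

(** * Removing the linear factor by passing to powers *)

Lemma bernoulli_ineq (R : realDomainType) (x : R) k :
  0 <= x -> 1 + k%:R * x <= (1 + x) ^+ k.
Proof.
move=> x0; elim: k => [|k IHk]; first by rewrite mul0r addr0 expr0.
rewrite exprSr; apply: le_trans (ler_wpM2r _ IHk); last by rewrite addr_ge0.
have k0 : 0 <= k%:R :> R by [].
by rewrite -[k.+1]addn1 natrD; nra.
Qed.

(** If x > y, the even powers (x/y)^(2k) grow at least quadratically in k by Bernoulli's inequality
    and outrun the linear factor. *)
Lemma ler_of_expr_linear (R : archiRealFieldType) (x y : R) n :
  0 < y -> (forall k, x ^+ k <= (2 * (k * n).+1)%:R * y ^+ k) -> x <= y.
Proof.
move=> y0 xy; rewrite leNgt; apply/negP => yx.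
pose z := x / y - 1.
have z0 : 0 < z by rewrite subr_gt0 ltr_pdivlMr // mul1r.
have zk k : (1 + z) ^+ k <= (2 * (k * n).+1)%:R.
  by rewrite addrC subrK expr_div_n ler_pdivrMr ?exprn_gt0.
(* With k >= 1 and k >= N / z^2, the linear factor satisfies 4kn + 2 <= kN <= (kz)^2 < (1 +
   kz)^2. *)
pose N : R := 4 * n%:R + 2.
pose k := (Num.bound (N / z ^+ 2)).+1.
have kN : N <= k%:R * z ^+ 2.
  rewrite -ler_pdivrMr ?exprn_gt0 // ltW // (lt_trans (archi_boundP _)) ?ltr_nat //.
  by rewrite divr_ge0 ?exprn_ge0 ?(ltW z0) // addr_ge0 ?mulr_ge0.
have k1 : 1 <= k%:R :> R by rewrite ler1n.
have := zk (k * 2)%N; rewrite exprM leNgt => /negP; apply.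
apply: (@lt_le_trans _ _ ((1 + k%:R * z) ^+ 2)); last first.
  have k_le := bernoulli_ineq k (ltW z0).
  have kz : 0 <= 1 + k%:R * z by rewrite addr_ge0 ?mulr_ge0 // ltW.
  by rewrite lerXn2r // nnegrE (le_trans kz).
have -> : (2 * (k * 2 * n).+1)%:R = 4 * k%:R * n%:R + 2 :> R.
  by rewrite !(natrM, mulrS); ring.
have kz : 0 <= k%:R * z by rewrite mulr_ge0 // ltW.
have : k%:R * N <= k%:R * (k%:R * z ^+ 2) by rewrite ler_wpM2l.
by rewrite /N; nra.
Qed.

(** This form passes to powers coordinate by coordinate; in the degenerate cases c = a and c = b,
    cancellation gives a = b. *)
Lemma progression_freeP (G : zmodType) (A : {pred G}) :
  progression_free A ->
  forall a b c, a \in A -> b \in A -> c \in A -> a + b = c *+ 2 -> a = b.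
Proof.
move=> Afree a b c aA bA cA abc; apply/eqP; apply: contraT => ab.
have [ac | ac] := eqVneq a c.
  by move: abc ab; rewrite -ac mulr2n => /addrI ->; rewrite eqxx.
have [bc | bc] := eqVneq b c.
  by move: abc ab; rewrite -bc mulr2n => /addIr ->; rewrite eqxx.
by case: (Afree a b c).
Qed.

Lemma card_progression_free_power (n k : nat) (A : {set 'rV['Z_4]_n}) :
  progression_free A ->
  exists2 B : {set {ffun 'I_k * 'I_n -> 'Z_4}},
    (forall a b c, a \in B -> b \in B -> c \in B -> a + b = c *+ 2 -> a = b)
    & #|B| = (#|A| ^ k)%N.
Proof.
move=> /progression_freeP Afree.
pose flat (f : {ffun 'I_k -> 'rV['Z_4]_n}) := [ffun ij : 'I_k * 'I_n => f ij.1 0 ij.2].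
have flatE f j i : flat f (j, i) = f j 0 i by rewrite ffunE.
exists [set flat f | f in ffun_on (mem A)].
  move=> _ _ _ /imsetP[f fA ->] /imsetP[g gA ->] /imsetP[h hA ->] fgh.
  congr flat; apply/ffunP => j.
  apply: (Afree _ _ (h j)); rewrite ?(ffun_onP fA) ?(ffun_onP gA) ?(ffun_onP hA) //.
  apply/rowP => i; have /ffunP/(_ (j, i)) := fgh.
  by rewrite mulr2n !ffunE mulr2n !mxE.
rewrite card_imset ?card_ffun_on ?card_ord // => f g /ffunP fg.
by apply/ffunP => j; apply/rowP => i; rewrite -!flatE.
Qed.

Lemma card_progression_free_row_le (R : archiRealFieldType) (mu : R) n
    (A : {set 'rV['Z_4]_n}) :
  0 < mu -> mu <= 1 -> progression_free A ->
  #|A|%:R <= ((1 + mu^-1) * (1 + mu ^+ 2)) ^+ n.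
Proof.
move=> mu0 mu1 Afree; apply: (@ler_of_expr_linear _ _ _ n) => [|k].
  by rewrite exprn_gt0 // mulr_gt0 // addr_gt0 ?invr_gt0 ?exprn_gt0.
have [B Bfree cardB] := card_progression_free_power k Afree.
have := card_progression_free_le mu0 mu1 Bfree.
by rewrite cardB card_prod !card_ord natrX -exprM (mulnC n k).
Qed.

(** * Entropy and the maximum gamma *)

Section Entropy.
Variable R : realType.
Implicit Types (x p e mu : R).

(** Use ln u <= u - 1 at u = p/x and u = (1 - p)/(1 - x); the resulting errors p - x and x - p
    cancel. *)
Lemma gibbs x p : 0 < x < 1 -> 0 < p < 1 ->
  entropy x <= - x * log2 p - (1 - x) * log2 (1 - p).
Proof.
move=> /andP[x0 x1] /andP[p0 p1].
have key (y q : R) : 0 < y -> 0 < q -> y * ln q - y * ln y <= q - y.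
  move=> y0 q0; rewrite -mulrBr -ln_div ?posrE //.
  have -> : q - y = y * (q / y - 1) by field; rewrite gt_eqF.
  have := @le_ln1Dx _ (q / y - 1); rewrite [1 + _]addrC subrK => le_ln.
  by rewrite ler_wpM2l ?(ltW y0) // le_ln // ltrBrDl subrr divr_gt0.
have ln2 : 0 < ln 2 :> R by rewrite ln_gt0 // ltr1n.
have := key x p x0 p0; have := key (1 - x) (1 - p).
rewrite !subr_gt0 => /(_ x1 p1).
move=> k1 k2; rewrite /entropy /log2 -subr_ge0.
have -> : - x * (ln p / ln 2) - (1 - x) * (ln (1 - p) / ln 2) -
   (- x * (ln x / ln 2) - (1 - x) * (ln (1 - x) / ln 2)) =
  (x * ln x - x * ln p + ((1 - x) * ln (1 - x) - (1 - x) * ln (1 - p))) / ln 2.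
  by field; rewrite gt_eqF.
rewrite divr_ge0 ?(ltW ln2) //; lra.
Qed.

(* The terms in e cancel because ln (p / (1 - p)) = 2 ln (q / (1 - q)). *)
Lemma cross_entropy_critical mu e : 0 < mu -> 
  let p := mu ^+ 2 / (1 + mu ^+ 2) in let q := mu / (1 + mu) in
  - (2^-1 - e) * log2 p - (1 - (2^-1 - e)) * log2 (1 - p) +
  (- (2 * e) * log2 q - (1 - 2 * e) * log2 (1 - q)) =
  log2 ((1 + mu^-1) * (1 + mu ^+ 2)).
Proof.
move=> mu0 p q.
have m1 : 0 < 1 + mu by rewrite addr_gt0.
have m2 : 0 < 1 + mu ^+ 2 by rewrite addr_gt0 ?exprn_gt0.
have -> : 1 - p = (1 + mu ^+ 2)^-1 by rewrite /p; field; rewrite gt_eqF.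
have -> : 1 - q = (1 + mu)^-1 by rewrite /q; field; rewrite gt_eqF.
have -> : 1 + mu^-1 = (1 + mu) / mu by field; rewrite gt_eqF.
rewrite /log2 /p /q !(lnM, lnV, ln_div, lnXn) ?posrE ?mulr_gt0 ?invr_gt0 ?exprn_gt0 //.
have ln2 : 0 < ln 2 :> R by rewrite ln_gt0 // ltr1n.
by field; rewrite gt_eqF.
Qed.

Lemma gamma_set_max mu : 0 < mu < 1 -> 2 * mu ^+ 3 + mu ^+ 2 - 1 = 0 ->
  is_max (gamma_set R) (2^-1 * log2 ((1 + mu^-1) * (1 + mu ^+ 2))).
Proof.
move=> /andP[mu0 mu1] mu_root.
have m1 : 0 < 1 + mu by rewrite addr_gt0.
have m2 : 0 < 1 + mu ^+ 2 by rewrite addr_gt0 ?exprn_gt0.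
have m1' := gt_eqF m1; have m2' := gt_eqF m2.
split.
  exists (2^-1 * (mu / (1 + mu))).
    rewrite /= in_itv /= mulr_gt0 ?divr_gt0 //=.
    have : mu / (1 + mu) < 2^-1 by rewrite ltr_pdivrMr //; lra.
    lra.
  rewrite -(cross_entropy_critical (2^-1 * (mu / (1 + mu))) mu0) /entropy.
  have -> : 2 * (2^-1 * (mu / (1 + mu))) = mu / (1 + mu) by field; rewrite m1'.
  (* Gibbs' inequality is an equality here, as 1/2 - e = p and 2 e = q. *)
  suff -> : 2^-1 - 2^-1 * (mu / (1 + mu)) = mu ^+ 2 / (1 + mu ^+ 2) by [].
  have -> : 2^-1 - 2^-1 * (mu / (1 + mu)) = (2 * (1 + mu))^-1 by field; rewrite m1'.
  (* Cross-multiplied, this is 1 + mu^2 = 2 mu^2 (1 + mu), the cubic equation. *)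
  apply/eqP; rewrite -[_^-1]mul1r eqr_div ?mulf_neq0 ?m1' ?m2' ?pnatr_eq0 //; apply/eqP; lra.
move=> x [e /=]; rewrite in_itv /= => /andP[e0 e4] <- {x}.
rewrite ler_wpM2l ?invr_ge0 // -(cross_entropy_critical e mu0).
apply: lerD; apply: gibbs; apply/andP; split; try lra.
- by rewrite divr_gt0 ?exprn_gt0.
- by rewrite ltr_pdivrMr //; lra.
- by rewrite divr_gt0.
- by rewrite ltr_pdivrMr //; lra.
Qed.
End Entropy.

(** The cubic is mu^2 times the derivative of (1 + 1/mu)(1 + mu^2), so its positive root minimizes
    this base over mu > 0. *)
Lemma critical_point_exists (R : rcfType) (a b : R) :
  a <= b -> 2 * a ^+ 3 + a ^+ 2 - 1 <= 0 -> 0 <= 2 * b ^+ 3 + b ^+ 2 - 1 ->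
  exists2 mu, a <= mu <= b & 2 * mu ^+ 3 + mu ^+ 2 - 1 = 0.
Proof.
pose P : {poly R} := 2 *: 'X^3 + 'X^2 - 1.
have PE x : P.[x] = 2 * x ^+ 3 + x ^+ 2 - 1 by rewrite !hornerE.
move=> ab Pa Pb; have [|x xab /rootP] := @poly_ivt R P a b ab.
  by rewrite !PE Pa.
by rewrite PE; exists x.
Qed.

(** * The numerical value of gamma and the final estimate *)

Local Open Scope classical_set_scope.

Theorem theorem1 (R : realType) :
  exists gamma : R,
    [/\ is_max (gamma_set R) gamma,
        `|gamma - 926 / 1000| < 1 / 2000
      & forall (n : nat) (A : {set 'rV['Z_4]_n}),
          (1 <= n)%N -> progression_free A ->
          (#|A|%:R : R) <= 4 `^ (gamma * n%:R) ].
Proof.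
(* Rational bounds around the root 0.6573..., tight enough to confine [G] between 3.61 and 3.611. *)
have [mu /andP[mu_ge mu_le] mu_root] : exists2 mu : R,
    140 / 213 <= mu <= 117 / 178 & 2 * mu ^+ 3 + mu ^+ 2 - 1 = 0.
  by apply: critical_point_exists; lra.
have mu0 : 0 < mu by lra.
have mu1 : mu < 1 by lra.
pose G := (1 + mu^-1) * (1 + mu ^+ 2).
(* The cubic turns [G] into a polynomial increasing in mu, so bounds on mu transfer directly. *)
have GE : G = 2 * mu * (1 + mu) ^+ 2.
  have m2 : 1 + mu ^+ 2 = 2 * mu ^+ 2 * (1 + mu) by lra.
  by rewrite /G m2; field; rewrite gt_eqF.
have [Glo Ghi] : 361 / 100 < G /\ G < 3611 / 1000 by rewrite GE; nra.
have G0 : 0 < G by lra.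
have ln2 : 0 < ln 2 :> R by rewrite ln_gt0 // ltr1n.
have ln4 : ln 4 = 2 * ln 2 :> R.
  by rewrite (_ : 4 = 2 ^+ 2) ?lnXn // -?natrX // mulr_natl.
(* This is the logarithm of [G] to base 4, so that 4^(gamma n) = G^n. *)
exists (2^-1 * log2 G); split.
- by apply: gamma_set_max; rewrite ?mu0.
- (* 0.9255 < 25/27 < gamma < 63/68 < 0.9265 *)
  have lo : 25 * ln 4 < 27 * ln G.
    rewrite !mulr_natl -!lnXn // ltr_ln ?posrE ?exprn_gt0 //.
    apply: (@lt_trans _ _ ((361 / 100) ^+ 27)); first lra.
    by rewrite ltrXn2r // ?nnegrE ltW.
  have hi : 68 * ln G < 63 * ln 4.
    rewrite !mulr_natl -!lnXn // ltr_ln ?posrE ?exprn_gt0 //.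
    apply: (@lt_trans _ _ ((3611 / 1000) ^+ 68)); last lra.
    by rewrite ltrXn2r // ?nnegrE ltW.
  rewrite ln4 in lo hi; rewrite ltr_norml /log2 mulrA; apply/andP; split.
    by rewrite ltrBrDl ltr_pdivlMr //; lra.
  by rewrite ltrBlDl ltr_pdivrMr //; lra.
- move=> n A _ /(card_progression_free_row_le mu0 (ltW mu1)) /le_trans; apply.
  rewrite powRrM powR_mulrn ?powR_ge0 //.
  suff -> : 4 `^ (2^-1 * log2 G) = G by [].
  rewrite /powR gt_eqF // ln4 -[RHS]lnK ?posrE //; congr expR.
  by rewrite /log2; field; rewrite gt_eqF.
Qed.
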